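(* Let $K$ be a field of characteristic zero, $R=K[x,y,z]$ with the standard grading, and let $a,b,c,\beta,\gamma$ be integers with $a\geq c\geq 2$, $1\leq \beta\leq b-1$ and $\max\{1,b-a+1\}\leq \gamma\leq \min\{b-1,c-1\}$. Consider the ideal $$I=(x^a,\ y^b-x^{b-\gamma}z^\gamma,\ z^c,\ x^{a-b+\gamma}y^{b-\beta},\ y^{b-\beta}z^{c-\gamma})\subset R.$$ If $a\leq 2b-c$, then $R/I$ has the weak Lefschetz property for every $\beta$ with $|a-b|+c-1\leq \beta\leq b-1$.
   Context: A graded Artinian $K$-algebra $A=\bigoplus_i [A]_i$ has the weak Lefschetz property (WLP) if there exists a linear form $L\in[A]_1$ such that the multiplication map $\times L:[A]_i\to[A]_{i+1}$ has maximal rank (i.e. is injective or surjective) for every $i$. *)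

(* Defs.v *)
From HB Require Import structures.
From mathcomp Require Import all_boot all_order all_algebra.
From mathcomp Require Import mpoly.
Set Implicit Arguments. Unset Strict Implicit. Unset Printing Implicit Defensive.
Import GRing.Theory.
Local Open Scope ring_scope.

Definition homog3 (K : fieldType) (d : nat) (p : {mpoly K[3]}) : bool :=
  p \is ishomog1 d (mdeg : measure 3).

Definition in_ideal (K : fieldType) (gens : seq {mpoly K[3]}) (f : {mpoly K[3]}) : Prop :=
  exists c : 'I_(size gens) -> {mpoly K[3]},
    f = \sum_(j < size gens) c j * gens`_j.

(* For A = R/I with I generated by homogeneous [gens], [A]_i = R_i / I_i where
   I_i = I ∩ R_i.  Multiplication by (the class of) L from [A]_i to [A]_{i+1}. *)
Definition mulL_injective (K : fieldType) (gens : seq {mpoly K[3]})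
    (L : {mpoly K[3]}) (i : nat) : Prop :=
  forall f, homog3 i f -> in_ideal gens (L * f) -> in_ideal gens f.

Definition mulL_surjective (K : fieldType) (gens : seq {mpoly K[3]})
    (L : {mpoly K[3]}) (i : nat) : Prop :=
  forall g, homog3 i.+1 g -> exists2 f, homog3 i f & in_ideal gens (g - L * f).

Definition WLP (K : fieldType) (gens : seq {mpoly K[3]}) : Prop :=
  exists L : {mpoly K[3]}, homog3 1 L /\
    forall i : nat, mulL_injective gens L i \/ mulL_surjective gens L i.

Definition vx (K : fieldType) : {mpoly K[3]} := 'X_(@Ordinal 3 0 isT).
Definition vy (K : fieldType) : {mpoly K[3]} := 'X_(@Ordinal 3 1 isT).
Definition vz (K : fieldType) : {mpoly K[3]} := 'X_(@Ordinal 3 2 isT).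

(* The generators of I = (x^a, y^b - x^(b-g) z^g, z^c, x^(a-b+g) y^(b-be), y^(b-be) z^(c-g)).
   (Natural-number subtractions are exact under the hypotheses of the theorem.) *)
Definition gensI (K : fieldType) (a b c be g : nat) : seq {mpoly K[3]} :=
  [:: vx K ^+ a;
      vy K ^+ b - vx K ^+ (b - g) * vz K ^+ g;
      vz K ^+ c;
      vx K ^+ (a + g - b) * vy K ^+ (b - be);
      vy K ^+ (b - be) * vz K ^+ (c - g)].

(* Main.v *)
Require Import Defs.
From HB Require Import structures.
From mathcomp Require Import all_boot all_order all_algebra.
From mathcomp Require Import mpoly zify ring.
Import GRing.Theory.
Local Open Scope ring_scope.

(** Take [L = x + y] and put [q = b - be], [p = a + g - b], [r = c - g],
    [m = min a b].  In degrees below [m] the ideal coincides with the monomial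
    ideal [(z^c, x^p y^q, y^q z^r) = (y^q, z^c) ∩ (x^p, z^r)], whose associated
    primes [(y, z)] and [(x, z)] do not contain [x + y]; hence multiplication
    by [L] is injective as long as the target degree is below [m].  In degree
    [d >= m], modulo [L] every monomial is up to sign [x^(d - t - u) y^u z^t]
    for any [u <= d - t], and the lower bound on [be] gives
    [d - t >= q] for [t < c] and [d - t >= p + q] for [t < r], so that a
    suitable choice of [u] lands in the monomial ideal and multiplication by
    [L] is surjective. *)

Local Notation ix := (@Ordinal 3 0 isT).
Local Notation iy := (@Ordinal 3 1 isT).
Local Notation iz := (@Ordinal 3 2 isT).

Section Ideal.
Variables (K : fieldType) (gens : seq {mpoly K[3]}).

Lemma in_ideal0 : in_ideal gens 0.
Proof. by exists (fun=> 0); rewrite big1 // => j _; rewrite mul0r. Qed.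

Lemma in_idealD f g : in_ideal gens f -> in_ideal gens g -> in_ideal gens (f + g).
Proof.
move=> [u ->] [v ->]; exists (fun j => u j + v j).
by rewrite -big_split; apply: eq_bigr => j _; rewrite /= mulrDl.
Qed.

Lemma in_idealMl h f : in_ideal gens f -> in_ideal gens (h * f).
Proof.
move=> [u ->]; exists (fun j => h * u j).
by rewrite big_distrr; apply: eq_bigr => j _; rewrite /= mulrA.
Qed.

Lemma in_idealN f : in_ideal gens f -> in_ideal gens (- f).
Proof. by rewrite -mulN1r; apply: in_idealMl. Qed.

Lemma in_idealZ k f : in_ideal gens f -> in_ideal gens (k *: f).
Proof. by rewrite -mul_mpolyC; apply: in_idealMl. Qed.

Lemma in_ideal_nth k : (k < size gens)%N -> in_ideal gens gens`_k.
Proof.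
move=> lt_k; exists (fun j => (j == Ordinal lt_k)%:R).
rewrite (bigD1 (Ordinal lt_k)) //= eqxx mul1r big1 ?addr0 //.
by move=> j /negbTE ->; rewrite mul0r.
Qed.

Lemma in_ideal_sum (I : eqType) (s : seq I) (F : I -> {mpoly K[3]}) :
  (forall i, i \in s -> in_ideal gens (F i)) ->
  in_ideal gens (\sum_(i <- s) F i).
Proof.
move=> Fs; rewrite big_seq.
by apply: big_ind => //; [apply: in_ideal0 | apply: in_idealD].
Qed.

End Ideal.

Section Monomials.
Variable K : fieldType.
Implicit Types (f h : {mpoly K[3]}) (n : 'X_{1..3}).

Definition mono (s u t : nat) : {mpoly K[3]} := vx K ^+ s * vy K ^+ u * vz K ^+ t.

Lemma mpolyX_mono n : 'X_[n] = mono (n ix) (n iy) (n iz).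
Proof.
rewrite mpolyXE_id !big_ord_recl big_ord0 mulr1 mulrA /mono /vx /vy /vz.
by congr ('X_ _ ^+ n _ * 'X_ _ ^+ n _ * 'X_ _ ^+ n _); apply: val_inj.
Qed.

Lemma mdeg3 n : mdeg n = (n ix + n iy + n iz)%N.
Proof.
rewrite mdegE !big_ord_recl big_ord0 addn0 addnA.
by congr (n _ + n _ + n _)%N; apply: val_inj.
Qed.

Lemma homog_mono d s u t : (s + u + t)%N = d -> homog3 d (mono s u t).
Proof.
move=> <-; rewrite /homog3 /mono /vx /vy /vz !mpolyXn -!mpolyXD dhomogX.
by rewrite /= !mdegD !mdegMn !mdeg1 !mul1n.
Qed.

Lemma mcoeffMX_eq0 f (k n : 'X_{1..3}) (i : 'I_3) :
  (n i < k i)%N -> (f * 'X_[k])@_n = 0.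
Proof.
move=> lt_nk; rewrite (mpolyE f) big_distrl raddf_sum big1 //= => m _.
rewrite -scalerAl -mpolyXD mcoeffZ mcoeffX; case: eqP => [E|]; last by rewrite mulr0.
by move: lt_nk; rewrite -E mnmDE; lia.
Qed.

Lemma mcoeffM_mono_eq0 f s u t n :
  [|| (n ix < s)%N, (n iy < u)%N | (n iz < t)%N] -> (f * mono s u t)@_n = 0.
Proof.
rewrite /mono /vx /vy /vz !mpolyXn -!mpolyXD => /or3P[] lt_n;
  [apply: (@mcoeffMX_eq0 _ _ _ ix) | apply: (@mcoeffMX_eq0 _ _ _ iy)
  | apply: (@mcoeffMX_eq0 _ _ _ iz)];
  by rewrite !mnmDE !mulmnE !mnm1E /=; lia.
Qed.

(* The coefficient of [('X_i + 'X_j) * f] at [n + U_(i)] is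
   [f@_n + f@_(n + U_(i) - U_(j))]; induct on the exponent [n j]. *)
Lemma mulXX_mcoeff_eq0 (i j : 'I_3) f (P : 'X_{1..3} -> Prop) :
  i != j ->
  (forall n, P n -> (0 < n j)%N -> P (n + U_(i) - U_(j))%MM) ->
  (forall n, P n -> (('X_i + 'X_j) * f)@_(n + U_(i)) = 0) ->
  forall n, P n -> f@_n = 0.
Proof.
move=> neq_ij stepP coef0 n.
elim: {n}(n j) {-2}n (erefl (n j)) => [|k IH] n nj Pn;
  have := coef0 n Pn; rewrite mulrC mulrDr mcoeffD.
- rewrite {1}addmC mcoeffMX (@mcoeffMX_eq0 f _ _ j) ?addr0 //.
  by rewrite mnmDE !mnm1E nj (negbTE neq_ij) eqxx.
- have le_jn : (U_(j) <= n + U_(i))%MM.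
    apply/mnm_lepP => l; rewrite mnmDE !mnm1E.
    by case: (j =P l) => // <-; rewrite nj.
  rewrite {1}addmC mcoeffMX -{1}(submK le_jn) addmC mcoeffMX.
  rewrite (IH (n + U_(i) - U_(j))%MM) ?addr0 //; last by apply: stepP; rewrite ?nj.
  by rewrite mnmBE mnmDE !mnm1E nj (negbTE neq_ij) eqxx addn0 subn1.
Qed.

End Monomials.

Arguments mono {K} s u t.

Section GensI.
Variables (K : fieldType) (a b c be g : nat).
Hypotheses (hba : (b - a + 1 <= g)%N) (hgb : (g < b)%N) (hgc : (g < c)%N).
Hypothesis hbe : (be < b)%N.

Local Notation I := (gensI K a b c be g).
Local Notation p := (a + g - b)%N.
Local Notation q := (b - be)%N.
Local Notation r := (c - g)%N.

(** The three monomial generators other than [x^a], read on exponents. They lie in [I] in every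
    degree, so [mono_in_ideal] serves both the injective and the surjective range. *)
Definition in_monomial_ideal (s u t : nat) : bool :=
  (c <= t)%N || (q <= u)%N && ((p <= s)%N || (r <= t)%N).

Lemma mono_in_ideal s u t : in_monomial_ideal s u t -> in_ideal I (mono s u t).
Proof.
have sub k : (k <= s)%N -> vx K ^+ s = vx K ^+ (s - k) * vx K ^+ k.
  by move=> le_k; rewrite -exprD subnK.
have sub' k : (k <= u)%N -> vy K ^+ u = vy K ^+ (u - k) * vy K ^+ k.
  by move=> le_k; rewrite -exprD subnK.
have sub'' k : (k <= t)%N -> vz K ^+ t = vz K ^+ (t - k) * vz K ^+ k.
  by move=> le_k; rewrite -exprD subnK.
rewrite /mono; case/orP => [/sub'' ->|/andP[/sub' -> /orP[/sub ->|/sub'' ->]]].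
- by rewrite mulrA; apply: in_idealMl; apply: (@in_ideal_nth _ I 2).
- rewrite (_ : _ * _ * _ = vx K ^+ (s - p) * vy K ^+ (u - q) * vz K ^+ t
    * (vx K ^+ p * vy K ^+ q)); last by ring.
  by apply: in_idealMl; apply: (@in_ideal_nth _ I 3).
- rewrite (_ : _ * _ * _ = vx K ^+ s * vy K ^+ (u - q) * vz K ^+ (t - r)
    * (vy K ^+ q * vz K ^+ r)); last by ring.
  by apply: in_idealMl; apply: (@in_ideal_nth _ I 4).
Qed.

(** The monomials [x^a], [y^b] and [x^(b-g) z^g] have degree [a] or [b], too large to divide [n];
    the remaining generators are monomials that do not divide [n] by assumption. *)
Lemma in_ideal_mcoeff_eq0 f (n : 'X_{1..3}) :
  in_ideal I f -> (mdeg n < minn a b)%N ->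
  ~~ in_monomial_ideal (n ix) (n iy) (n iz) -> f@_n = 0.
Proof.
rewrite mdeg3 /in_monomial_ideal => -[u ->] lt_n notM.
rewrite raddf_sum !big_ord_recl big_ord0 /=.
have -> : vx K ^+ a = mono a 0 0 by rewrite /mono !expr0 !mulr1.
have -> : vy K ^+ b = mono 0 b 0 by rewrite /mono !expr0 mulr1 mul1r.
have -> : vz K ^+ c = mono 0 0 c by rewrite /mono !expr0 !mul1r.
have -> : vx K ^+ (b - g) * vz K ^+ g = mono (b - g) 0 g by rewrite /mono !expr0 mulr1.
have -> : vx K ^+ p * vy K ^+ q = mono p q 0 by rewrite /mono !expr0 mulr1.
have -> : vy K ^+ q * vz K ^+ r = mono 0 q r by rewrite /mono !expr0 mul1r.
rewrite mulrBr mcoeffB !mcoeffM_mono_eq0 ?subr0 ?addr0 //; lia.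
Qed.

Lemma mulL_injective_low i :
  (i.+1 < minn a b)%N -> mulL_injective I (vx K + vy K) i.
Proof.
move=> lt_i f homf LfI; rewrite (mpolyE f); apply: in_ideal_sum => n nf.
apply/in_idealZ; rewrite mpolyX_mono; apply: mono_in_ideal.
have degn := dhomog_mf homf nf; rewrite /= mdeg3 in degn.
rewrite mcoeff_msupp in nf; apply: contraNT nf => notM; apply/eqP.
have step (k : 'X_{1..3}) (s t : 'I_3) : (0 < k t)%N ->
    mdeg (k + U_(s) - U_(t))%MM = mdeg k.
  move=> kt; have le_t : (U_(t) <= k + U_(s))%MM.
    by apply/mnm_lepP => l; rewrite mnmDE !mnm1E; case: (t =P l) => // <-; lia.
  have := congr1 mdeg (submK le_t).
  by rewrite !mdegD !mdeg1 !addn1 => -[].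
(* A monomial outside an intersection of two ideals is outside one of them: [(y^q, z^c)] or
   [(x^p, z^r)]. *)
have [lowy|lowx] : ((n iy < q) && (n iz < c) \/ (n ix < p) && (n iz < r))%N.
- by move: notM; rewrite /in_monomial_ideal; lia.
(* Trading [y] for [x] keeps the degree and stays outside [(y^q, z^c)], as does multiplying by [x].
   The other case exchanges the roles of [x] and [y]. *)
- apply: (@mulXX_mcoeff_eq0 _ ix iy f
    (fun k => mdeg k = i /\ (k iy < q)%N && (k iz < c)%N)) => // [k|k|].
  + move=> [degk lowk] ky; split; first by rewrite step.
    by move: lowk; rewrite !mnmBE !mnmDE !mnm1E /=; lia.
  + move=> [degk lowk]; apply: in_ideal_mcoeff_eq0 => //.
      by rewrite mdegD mdeg1 degk addn1.
    by move: lowk; rewrite /in_monomial_ideal !mnmDE !mnm1E /=; lia.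
  + by split=> //; rewrite mdeg3.
- apply: (@mulXX_mcoeff_eq0 _ iy ix f
    (fun k => mdeg k = i /\ (k ix < p)%N && (k iz < r)%N)) => // [k|k|].
  + move=> [degk lowk] ky; split; first by rewrite step.
    by move: lowk; rewrite !mnmBE !mnmDE !mnm1E /=; lia.
  + move=> [degk lowk]; rewrite addrC; apply: in_ideal_mcoeff_eq0 => //.
      by rewrite mdegD mdeg1 degk addn1.
    by move: lowk; rewrite /in_monomial_ideal !mnmDE !mnm1E /=; lia.
  + by split=> //; rewrite mdeg3.
Qed.

Section Image.
Variable i : nat.

(** Surjectivity for a single target [h]; being closed under linear combinations, it need only be
    checked on monomials. *)
Definition in_imageL (h : {mpoly K[3]}) : Prop :=
  exists2 f, homog3 i f & in_ideal I (h - (vx K + vy K) * f).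

Lemma in_imageL_sum (s : seq 'X_{1..3}) (k : 'X_{1..3} -> K) :
  (forall n, n \in s -> in_imageL 'X_[n]) ->
  in_imageL (\sum_(n <- s) k n *: 'X_[n]).
Proof.
move=> Xs; rewrite big_seq; apply: big_ind => [|h1 h2|n /Xs].
- by exists 0; [apply: dhomog0 | rewrite mulr0 subr0; apply: in_ideal0].
- move=> [f1 hf1 I1] [f2 hf2 I2]; exists (f1 + f2); first exact: dhomogD.
  rewrite (_ : _ - _ = (h1 - (vx K + vy K) * f1) + (h2 - (vx K + vy K) * f2));
    last by ring.
  exact: in_idealD.
- move=> [f hf If]; exists (k n *: f); first exact: dhomogZ.
  by rewrite -scalerAr -scalerBr; apply: in_idealZ.
Qed.

(** The two monomials add up to [(x + y) * mono s u t], so each is minus the other modulo the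
    image. *)
Lemma in_imageL_swap s u t : (s + u + t)%N = i ->
  in_imageL (mono s.+1 u t) <-> in_imageL (mono s u.+1 t).
Proof.
move=> deg_i; have hm := homog_mono K i s u t deg_i.
have E : mono s.+1 u t + mono s u.+1 t = (vx K + vy K) * mono s u t.
  by rewrite /mono !exprS; ring.
have flip h1 h2 : h1 + h2 = (vx K + vy K) * mono s u t ->
    in_imageL h1 -> in_imageL h2.
  move=> E12 [f hf If]; exists (mono s u t - f); first exact: rpredB.
  rewrite (_ : _ - _ = - (h1 - (vx K + vy K) * f)); first exact: in_idealN.
  by rewrite mulrBr -E12; ring.
by split; apply: flip => //; rewrite addrC.
Qed.

Lemma in_imageL_shift s u t : (s + u + t)%N = i.+1 ->
  in_imageL (mono (s + u) 0 t) <-> in_imageL (mono s u t).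
Proof.
elim: u s => [|u IH] s; first by rewrite addn0.
move=> deg; rewrite addnS -addSn IH; last by lia.
by apply: in_imageL_swap; lia.
Qed.

Lemma in_imageL_ideal s u t :
  in_monomial_ideal s u t -> in_imageL (mono s u t).
Proof.
move=> M; exists 0; first exact: dhomog0.
by rewrite mulr0 subr0; apply: mono_in_ideal.
Qed.

End Image.

(** With truncated subtraction, [(a - b) + (b - a)] is [|a - b|]. The bound on [be] amounts to
    [q + c - 1 <= max] of nothing beyond [minn a b], that is [q + c - 1 <= minn a b] follows from
    it, and so does [p + q + r - 1 <= minn a b]. *)
Lemma mulL_surjective_high i :
  ((a - b) + (b - a) + c - 1 <= be)%N ->
  (minn a b <= i.+1)%N -> mulL_surjective I (vx K + vy K) i.
Proof.
move=> hdiff le_i h homh; rewrite -/(in_imageL i h) (mpolyE h).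
apply: in_imageL_sum => n /(dhomog_mf homh); rewrite /= mdeg3 mpolyX_mono => degn.
have [le_c|lt_c] := leqP c (n iz).
  by apply: in_imageL_ideal; rewrite /in_monomial_ideal le_c.
(* All of [y] is turned into [x], then exactly [q] factors are turned back. If [n iz < r], at least
   [p] factors [x] remain; otherwise [z^r] already divides. *)
rewrite -in_imageL_shift //.
have -> : (n ix + n iy = (n ix + n iy - q) + q)%N by lia.
rewrite in_imageL_shift; last by lia.
by apply: in_imageL_ideal; rewrite /in_monomial_ideal; lia.
Qed.

End GensI.

Theorem theorem3p6 (K : fieldType) (hK : [pchar K] =i pred0)
  (a b c be g : nat)
  (hac : (c <= a)%N) (hc : (2 <= c)%N)
  (hbe1 : (1 <= be)%N) (hbe2 : (be <= b - 1)%N)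
  (hg1 : (maxn 1 (b - a + 1) <= g)%N) (hg2 : (g <= minn (b - 1) (c - 1))%N)
  (habc : (a <= 2 * b - c)%N)
  (hbe3 : ((a - b) + (b - a) + c - 1 <= be)%N) :
  WLP (gensI K a b c be g).
Proof.
have hba : (b - a + 1 <= g)%N by lia.
have hgb : (g < b)%N by lia.
have hgc : (g < c)%N by lia.
have hbe : (be < b)%N by lia.
exists (vx K + vy K); split.
  by apply: dhomogD; rewrite dhomogX /= mdeg1.
move=> i; have [lt_i|le_i] := ltnP i.+1 (minn a b).
- by left; apply: mulL_injective_low.
- by right; apply: mulL_surjective_high.
Qed.
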